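(* Let $G\in\mathcal{G}$, with cliques on $X=\{x_1,\ldots,x_m\}$ and $Y=\{y_1,\ldots,y_n\}$, where $m=n>1$, and suppose $\{x_1,y_1\}$ is the only edge of $G$ with one endpoint in $X$ and the other in $Y$. Then $T_2(G)$ is not well-covered.
   Context: $\mathcal{G}$ is the class of graphs obtained by taking the disjoint union of a complete graph $K_m$ with vertex set $X=\{x_1,\ldots,x_m\}$ and a complete graph $K_n$ with vertex set $Y=\{y_1,\ldots,y_n\}$, where $n\geq m$, and then adding some (possibly no) edges each joining a vertex of $X$ to a vertex of $Y$. The $2$-token graph $T_2(G)$ has as vertices the $2$-subsets of $V(G)$, two of them adjacent if their symmetric difference is an edge of $G$. A graph is well-covered if all of its maximal (with respect to inclusion) independent sets have the same cardinality. *)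

(* Defs.v *)
From mathcomp Require Import all_boot.

Set Implicit Arguments.
Unset Strict Implicit.
Unset Printing Implicit Defensive.

Record sgraph := SGraph {
  vertex :> finType;
  adj : rel vertex;
  adj_sym : symmetric adj;
  adj_irrefl : irreflexive adj }.

Definition clique (G : sgraph) (A : {set G}) :=
  forall u v, u \in A -> v \in A -> u != v -> adj u v.

Definition independent (G : sgraph) (A : {set G}) :=
  [forall u in A, forall v in A, ~~ adj u v].

Definition well_covered (G : sgraph) :=
  forall A B : {set G},
    maxset (@independent G) A -> maxset (@independent G) B -> #|A| = #|B|.

Definition symdiff (T : finType) (A B : {set T}) := (A :\: B) :|: (B :\: A).

Section TokenGraph.

Variable G : sgraph.

Definition token2 := {A : {set G} | #|A| == 2}.

Definition token2_adj : rel token2 := fun A B =>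
  [exists u : G, exists v : G,
     adj u v && (symdiff (val A) (val B) == [set u; v])].

Lemma token2_adj_sym : symmetric token2_adj.
Proof. by move=> A B; rewrite /token2_adj /symdiff setUC. Qed.

Lemma token2_adj_irrefl : irreflexive token2_adj.
Proof.
move=> A; apply/negbTE/existsP => -[u /existsP[v /andP[_ /eqP E]]].
by have := set21 u v; rewrite -E /symdiff setDv setU0 inE.
Qed.

Definition token2_graph := SGraph token2_adj_sym token2_adj_irrefl.

End TokenGraph.

(* [in_calG X Y]: the graph G is obtained from the disjoint union of complete
   graphs on X and on Y, with |X| <= |Y|, by adding edges between X and Y. *)
Definition in_calG (G : sgraph) (X Y : {set G}) :=
  [/\ [disjoint X & Y], X :|: Y = [set: G], clique X, clique Y & #|X| <= #|Y|].

(* Main.v *)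
(* Write [xy] for the token configuration {x, y}, pick x2 in X and y2 in Y
   other than x1, y1, and let f be a bijection from X \ {x1, x2} onto
   Y \ {y1, y2}.  The configurations x1x2, x1y2 and x f(x) form an independent
   set S.  A maximal independent set B containing S holds no neighbour of x1y1
   or x2y2 besides x1y2: the remaining ones are excluded by S, and the
   exclusion of x2y1 by x1x2 is where the edge x1y1 enters.  Exchanging x1y2
   for x1y1 and x2y2 thus gives an independent set larger than B. *)
Require Import Defs.
From mathcomp Require Import all_boot.

Set Implicit Arguments.
Unset Strict Implicit.

Lemma independentP (G : sgraph) (A : {set G}) :
  reflect {in A &, forall u v, ~~ adj u v} (independent A).
Proof.
apply: (iffP forall_inP) => [H u v uA vA|H u uA].
  by move/forall_inP: (H u uA); apply.
by apply/forall_inP => v; apply: H.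
Qed.

Section TwoTokens.

Variable G : sgraph.
Implicit Types (s t : token2 G) (a b c u v : G).

Lemma token2_ex a b : a != b -> exists t : token2 G, val t = [set a; b].
Proof.
move=> ab; have cab : #|[set a; b]| == 2 by rewrite cards2 ab.
by exists (Sub [set a; b] cab); rewrite SubK.
Qed.

Lemma token2_neq t a b : val t = [set a; b] -> a != b.
Proof. by move=> E; have := valP t; rewrite E cards2; case: (a != b). Qed.

Lemma adj_neq u v : adj u v -> u != v.
Proof. by apply: contraTneq => ->; rewrite adj_irrefl. Qed.

Lemma symdiff_share a b c :
  a != b -> a != c -> b != c -> symdiff [set a; b] [set a; c] = [set b; c].
Proof.
move=> ab ac bc; apply/setP => z; rewrite !inE.
case: (eqVneq z a) => [->|_] /=; first by rewrite (negbTE ab) (negbTE ac).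
case: (eqVneq z b) => [->|_] /=; first by rewrite bc.
by case: (z == c).
Qed.

Lemma token2_adjI s t a b c :
  val s = [set a; b] -> val t = [set a; c] -> adj b c -> token2_adj s t.
Proof.
move=> Es Et bc; apply/existsP; exists b; apply/existsP; exists c.
rewrite bc Es Et symdiff_share ?eqxx //; first exact: token2_neq Es.
  exact: token2_neq Et.
exact: adj_neq.
Qed.

(** The two differences are disjoint with union an edge, so their sizes add up to 2. They are
    equally large because [s] and [t] are, hence each is a singleton and one token is common. *)
Lemma token2_adjE s t : token2_adj s t ->
  exists a b c, [/\ val s = [set a; b], val t = [set a; c] & adj b c].
Proof.
case/existsP=> u /existsP[v /andP[uv /eqP E]].
have dis : [disjoint val s :\: val t & val t :\: val s].
  by apply/pred0P => z /=; rewrite !inE; do 2 case: (z \in _).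
have := cardsUI (val s :\: val t) (val t :\: val s).
rewrite (disjoint_setI0 dis) cards0 addn0 -/(symdiff _ _) E cards2 (adj_neq uv).
have := cardsID (val t) (val s); have := cardsID (val s) (val t).
rewrite (eqP (valP s)) (eqP (valP t)) (setIC (val t)) => Et Es Est.
have [Ks [Kt KI]] :
    #|val s :\: val t| = 1 /\ #|val t :\: val s| = 1 /\ #|val s :&: val t| = 1.
  case: #|_ :&: _| Es Et Est => [|[|[|n]]].
  - by rewrite !add0n => Es Et; rewrite Es Et.
  - by rewrite !addSn !add0n => -[Es] [Et]; rewrite Es Et.
  - by rewrite !addSn !add0n => -[Es] [Et]; rewrite Es Et.
  - by [].
move/eqP/cards1P: Ks => [b Eb]; move/eqP/cards1P: Kt => [c Ec].
move/eqP/cards1P: KI => [a Ea]; exists a, b, c; split.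
- by rewrite -(setID (val s) (val t)) Ea Eb.
- by rewrite -(setID (val t) (val s)) (setIC (val t)) Ea Ec.
(* Both [u] and [v] lie in {b, c}, and irreflexivity leaves only the edge bc up to order. *)
have := set21 u v; have := set22 u v; rewrite -E /symdiff Eb Ec !inE.
case/orP=> /eqP ev; case/orP=> /eqP eu; move: uv; rewrite ev eu ?adj_irrefl //.
by rewrite adj_sym.
Qed.

(** Used in contrapositive form: disjoint configurations are never adjacent. *)
Lemma token2_adj_share s t : token2_adj s t ->
  exists2 a, a \in val s & a \in val t.
Proof.
by case/token2_adjE => a [b [c [-> -> _]]]; exists a; rewrite set21.
Qed.

Lemma token2_adj_pair s t x y : val s = [set x; y] -> token2_adj s t ->
     (exists2 v, val t = [set x; v] & adj y v)
  \/ (exists2 v, val t = [set y; v] & adj x v).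
Proof.
move=> Es /token2_adjE[a [b [c [Es' Et bc]]]].
have ab := token2_neq Es'.
have := set21 a b; have := set22 a b; rewrite -Es' Es !inE.
case/orP=> /eqP eb; case/orP=> /eqP ea; subst a b.
- by rewrite eqxx in ab.
- by right; exists c.
- by left; exists c.
- by rewrite eqxx in ab.
Qed.

End TwoTokens.

(** The enumerations of [A] and [B] are matched index by index. The default of [nth] is [x] itself,
    as [T] may be empty; it is never returned for [x] in [A]. Injectivity on [A] follows from the
    size of the image. *)
Lemma eq_card_bij (T : finType) (A B : {set T}) : #|A| = #|B| ->
  exists2 f : T -> T, {in A &, injective f} & f @: A = B.
Proof.
move=> cAB; have sz : size (enum A) = size (enum B) by rewrite -!cardE.
pose f x := nth x (enum B) (index x (enum A)).
have fA : f @: A = B.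
  apply/setP => y; apply/imsetP/idP => [[x xA ->]|yB].
    by rewrite -mem_enum mem_nth // -sz index_mem mem_enum.
  have ly : index y (enum B) < size (enum A) by rewrite sz index_mem mem_enum.
  exists (nth y (enum A) (index y (enum B))); first by rewrite -mem_enum mem_nth.
  rewrite /f index_uniq ?enum_uniq // (set_nth_default y) -?sz //.
  by rewrite nth_index // mem_enum.
by exists f => //; apply/imset_injP; rewrite fA cAB.
Qed.

Theorem theorem7p1 (G : sgraph) (X Y : {set G}) (x1 y1 : G)
    (hG : in_calG X Y)
    (hcard : #|X| = #|Y|) (hgt1 : 1 < #|X|)
    (hx1 : x1 \in X) (hy1 : y1 \in Y)
    (hedge : forall x y : G, x \in X -> y \in Y ->
       (adj x y <-> x = x1 /\ y = y1)) :
  ~ well_covered (token2_graph G).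
Proof.
case: hG => disXY XUY cX cY _ wc.
have XorY z : z \in X \/ z \in Y.
  by apply/orP; have := in_setT z; rewrite -XUY inE.
have neqXY x y : x \in X -> y \in Y -> x != y.
  by move=> xX; apply: contraTneq => <-; rewrite (disjointFr disXY xX).
have nadj x y : x \in X -> y \in Y -> x != x1 \/ y != y1 -> ~ adj x y.
  by move=> xX yY ne /(hedge x y xX yY)[ex ey]; case: ne; rewrite ?ex ?ey eqxx.
have /card_gt0P[x2] : 0 < #|X :\ x1|.
  by rewrite -ltnS; move: hgt1; rewrite (cardsD1 x1) hx1.
rewrite !inE => /andP[x21 x2X].
have /card_gt0P[y2] : 0 < #|Y :\ y1|.
  by rewrite -ltnS; move: hgt1; rewrite hcard (cardsD1 y1) hy1.
rewrite !inE => /andP[y21 y2Y].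
have y12 : y1 != y2 by rewrite eq_sym.
have x12 : x1 != x2 by rewrite eq_sym.
have [f finj fX] : exists2 f : G -> G,
    {in X :\ x1 :\ x2 &, injective f} & f @: (X :\ x1 :\ x2) = Y :\ y1 :\ y2.
  apply: eq_card_bij; apply/eqP; rewrite -(eqn_add2l 2); apply/eqP.
  move: hcard; rewrite (cardsD1 x1 X) (cardsD1 x2 (X :\ x1)) (cardsD1 y1 Y).
  by rewrite (cardsD1 y2 (Y :\ y1)) !inE hx1 hy1 x2X y2Y x21 y21.
have fP x : x \in X -> x != x1 -> x != x2 ->
    [/\ f x \in Y, f x != y1 & f x != y2].
  move=> xX n1 n2; have : f x \in f @: (X :\ x1 :\ x2).
    by apply: imset_f; rewrite !inE n1 n2.
  by rewrite fX !inE => /and3P[].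
(* Naming: [t12] is x1x2, and [c12], [c11], [c22] are x1y2, x1y1, x2y2. *)
have [t12 E12] := token2_ex x12.
have [c12 F12] := token2_ex (neqXY _ _ hx1 y2Y).
have [c11 F11] := token2_ex (neqXY _ _ hx1 hy1).
have [c22 F22] := token2_ex (neqXY _ _ x2X y2Y).
pose D := [set t : token2 G | [exists x in X :\ x1 :\ x2, val t == [set x; f x]]].
have DP t : t \in D -> exists x,
    [/\ x \in X, x != x1, x != x2 & val t = [set x; f x]].
  rewrite inE => /exists_inP[x]; rewrite !inE => /and3P[n2 n1 xX] /eqP Et.
  by exists x.
have inD x : x \in X -> x != x1 -> x != x2 ->
    exists2 t, t \in D & val t = [set x; f x].
  move=> xX n1 n2; have [fY _ _] := fP x xX n1 n2.
  have [t Et] := token2_ex (neqXY _ _ xX fY).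
  by exists t => //; rewrite inE; apply/exists_inP; exists x; rewrite ?inE ?n1 ?n2 ?Et.
pose S : {set token2_graph G} := t12 |: (c12 |: D).
(* These share x1 and differ by x2y2, which is not the cross edge x1y1. *)
have nTC : ~~ token2_adj c12 t12.
  apply/negP => /(token2_adj_pair F12)[[v]|[v]].
    rewrite E12 => E; have : v \in [set x1; x2] by rewrite E set22.
    rewrite !inE adj_sym => /orP[]/eqP->; apply: nadj => //; first by right.
    by left.
  move=> E; have : y2 \in [set x1; x2] by rewrite -E12 E set21.
  by rewrite !inE => /orP[]/eqP ey; have := neqXY _ _ _ y2Y;
     [move/(_ _ hx1) | move/(_ _ x2X)]; rewrite ey eqxx.
(* Neither x nor f(x) is among x1, x2, y2, so the configurations are disjoint. *)
have nD t s : t \in D -> s = t12 \/ s = c12 -> ~~ token2_adj t s.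
  move=> /DP[x [xX n1 n2 Et]] Hs; apply/negP => /token2_adj_share[a].
  have [fY m1 m2] := fP x xX n1 n2.
  rewrite Et => a1 a2; case: Hs a2 => ->; rewrite ?E12 ?F12 !inE.
    by move: a1; rewrite !inE => /orP[]/eqP->; rewrite ?(negbTE n1) ?(negbTE n2) //;
       rewrite ![f x == _]eq_sym !(negbTE (neqXY _ _ _ fY)).
  move: a1; rewrite !inE => /orP[]/eqP->; rewrite ?(negbTE n1) ?(negbTE m2) ?orbF /=.
    by rewrite (negbTE (neqXY _ _ xX y2Y)).
  by rewrite eq_sym (negbTE (neqXY _ _ hx1 fY)).
(* A common vertex in X gives x = z directly; one in Y does so by injectivity of [f]. *)
have nDD t s : t \in D -> s \in D -> ~~ token2_adj t s.
  move=> /DP[x [xX n1 n2 Et]] /DP[z [zX m1 m2 Es]].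
  have [fxY _ _] := fP x xX n1 n2; have [fzY _ _] := fP z zX m1 m2.
  apply/negP => ats.
  have exz : x = z.
    have [a] := token2_adj_share ats.
    rewrite Et Es !inE => /orP[]/eqP->.
      by rewrite (negbTE (neqXY _ _ xX fzY)) orbF => /eqP.
    rewrite eq_sym (negbTE (neqXY _ _ zX fxY)) /= => /eqP.
    by apply: finj; rewrite !inE ?n1 ?n2 ?m1 ?m2.
  have ets : t = s by apply: val_inj; rewrite Et Es exz.
  by rewrite ets token2_adj_irrefl in ats.
have iS : independent S.
  apply/independentP => s t /setU1P[->|/setU1P[->|sD]] /setU1P[->|/setU1P[->|tD]].
  - by rewrite adj_irrefl.
  - by rewrite adj_sym.
  - by rewrite adj_sym; apply: nD => //; left.
  - exact: nTC.
  - by rewrite adj_irrefl.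
  - by rewrite adj_sym; apply: nD => //; right.
  - by apply: nD => //; left.
  - by apply: nD => //; right.
  - exact: nDD.
have [B maxB SB] := maxset_exists iS.
have iB := maxsetp maxB; move/independentP: iB => iB.
have t12B : t12 \in B by apply: (subsetP SB); rewrite !inE eqxx.
have c12B : c12 \in B by apply: (subsetP SB); rewrite !inE eqxx orbT.
have DB t : t \in D -> t \in B.
  by move=> tD; apply: (subsetP SB); do 2 apply: setU1r.
(* The shared token [a] is written first; later uses of [setUC] reorder pairs to fit this. *)
have blocked t s a b c : t \in B -> s \in B ->
    val t = [set a; b] -> val s = [set a; c] -> ~ adj b c.
  move=> tB sB Et Es bc; have /negP := iB _ _ tB sB; apply.
  exact: (token2_adjI Et Es bc).
have n11 t : t \in B -> t != c12 -> ~~ token2_adj c11 t.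
  move=> tB tc; apply/negP => /(token2_adj_pair F11)[[v Et av]|[v Et av]].
    (* Here x1 stays and y1 moves to v. For v in Y other than y2, the result is adjacent to x1y2. *)
    have vx1 : v != x1 by rewrite eq_sym; exact: token2_neq Et.
    have [vX|vY] := XorY v.
      by apply: (nadj v y1) => //; [left | rewrite adj_sym].
    have [ev|nv] := eqVneq v y2.
      by move/eqP: tc; apply; apply: val_inj; rewrite Et F12 ev.
    by apply: (blocked _ _ _ _ _ tB c12B Et F12); apply: cY.
  (* Here y1 stays and x1 moves to v in X. For v = x2 the result is adjacent to x1x2 through x1y1;
     otherwise it is adjacent to v f(v), since f(v) differs from y1. *)
  have vy1 : v != y1 by rewrite eq_sym; exact: token2_neq Et.
  have [vX|vY] := XorY v; last by apply: (nadj x1 v) => //; right.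
  have [ev|nv] := eqVneq v x2.
    rewrite ev setUC in Et; rewrite setUC in E12.
    apply: (blocked _ _ _ _ _ tB t12B Et E12).
    by rewrite adj_sym; apply/hedge.
  have nv1 : v != x1 by rewrite eq_sym; exact: adj_neq av.
  have [s sD Es] := inD v vX nv1 nv; have [fY m1 m2] := fP v vX nv1 nv.
  rewrite setUC in Et; apply: (blocked _ _ _ _ _ tB (DB _ sD) Et Es).
  by apply: cY => //; rewrite eq_sym.
have n22 t : t \in B -> t != c12 -> ~~ token2_adj c22 t.
  move=> tB tc; apply/negP => /(token2_adj_pair F22)[[v Et av]|[v Et av]].
    have [vX|vY] := XorY v.
      by apply: (nadj v y2) => //; [right | rewrite adj_sym].
    have [ev|nv1] := eqVneq v y1.
      rewrite ev in Et; rewrite setUC in E12.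
      apply: (blocked _ _ _ _ _ tB t12B Et E12).
      by rewrite adj_sym; apply/hedge.
    have nv2 : v != y2 by rewrite eq_sym; exact: adj_neq av.
    (* Surjectivity of [f] gives v = f(x), and x2v is adjacent to x f(x) inside the clique X. *)
    have : v \in f @: (X :\ x1 :\ x2) by rewrite fX !inE nv1 nv2.
    case/imsetP=> x; rewrite !inE => /and3P[m2 m1 xX] ev.
    have [s sD Es] := inD x xX m1 m2.
    rewrite setUC in Et; rewrite setUC -ev in Es.
    apply: (blocked _ _ _ _ _ tB (DB _ sD) Et Es).
    by apply: cX => //; rewrite eq_sym.
  (* Now y2 stays and x2 moves to v in X: either v = x1, giving x1y2 itself, or the result is
     adjacent to x1y2. *)
  have [vX|vY] := XorY v; last by apply: (nadj x2 v) => //; left.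
  have [ev|nv] := eqVneq v x1.
    by move/eqP: tc; apply; apply: val_inj; rewrite Et F12 ev setUC.
  rewrite setUC in F12; apply: (blocked _ _ _ _ _ tB c12B Et F12).
  exact: cX.
have n1122 : ~~ token2_adj c11 c22.
  apply/negP => /token2_adj_share[a]; rewrite F11 F22 !inE => /orP[]/eqP->.
    by rewrite (negbTE x12) (negbTE (neqXY _ _ hx1 y2Y)).
  by rewrite (negbTE y12) orbF eq_sym (negbTE (neqXY _ _ x2X hy1)).
(* Both new configurations are adjacent to x1y2, a member of [B], so neither was in [B] and the
   exchange gains exactly one element. *)
have c11B : c11 \notin B.
  by apply/negP => c11B; apply: (blocked _ _ _ _ _ c11B c12B F11 F12); apply: cY.
have c22B : c22 \notin B.
  rewrite setUC in F12; rewrite setUC in F22.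
  by apply/negP => c22B; apply: (blocked _ _ _ _ _ c22B c12B F22 F12); apply: cX.
have c1122 : c11 != c22.
  apply/eqP => e; have : x1 \in val c22 by rewrite -e F11 set21.
  by rewrite F22 !inE (negbTE x12) (negbTE (neqXY _ _ hx1 y2Y)).
pose A0 : {set token2_graph G} := c11 |: (c22 |: (B :\ c12)).
have iA0 : independent A0.
  apply/independentP => s t.
  case/setU1P=> [->|/setU1P[->|/setD1P[sc sB]]];
    case/setU1P=> [->|/setU1P[->|/setD1P[tc tB]]].
  - by rewrite adj_irrefl.
  - exact: n1122.
  - exact: n11.
  - by rewrite adj_sym; exact: n1122.
  - by rewrite adj_irrefl.
  - exact: n22.
  - by rewrite adj_sym; exact: n11.
  - by rewrite adj_sym; exact: n22.
  - exact: iB.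
have cA0 : #|A0| = #|B|.+1.
  rewrite (cardsD1 c12 B) c12B /A0 !cardsU1.
  by rewrite !inE (negbTE c1122) (negbTE c11B) (negbTE c22B) !andbF.
(* [A0] need not be maximal, but any maximal independent set above it is still larger than [B]. *)
have [A maxA A0A] := maxset_exists iA0.
by have := subset_leq_card A0A; rewrite cA0 (wc _ _ maxA maxB) ltnn.
Qed.
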